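(* Let $S$ be a finitely generated $E$-unitary special inverse monoid with recursively bounded group distortion and such that the maximal group image has decidable word problem. Then the following four decision problems are all Turing equivalent: (1) the word problem for the monoid $S$; (2) the problem of deciding whether a given word represents $1$ in the monoid $S$; (3) the problem of deciding whether a given word represents an element of the $\mathcal{R}$-class of $1$ in the monoid $S$; and (4) the membership problem for the prefix monoid of $S$ in the maximal group image.
   Context: An inverse monoid is a monoid $S$ in which every $s$ has a unique $s^{-1}$ with $ss^{-1}s=s$ and $s^{-1}ss^{-1}=s^{-1}$. $\mathrm{Inv}\langle X\mid R\rangle$ is the quotient of the free inverse monoid on $X$ by the congruence generated by $R$; an inverse monoid is special if it has such a presentation in which all relations have the form $w_i=1$ with $w_i\in(X\cup X^{-1})^*$. Elements $s,t$ are $\mathcal{R}$-related iff $ss^{-1}=tt^{-1}$. The maximal group image is $G=S/\sigma$, where $\sigma$ is the least congruence identifying all idempotents; $\sigma\colon S\to G$ also denotes the natural homomorphism. $S$ is $E$-unitary if $\sigma$ is injective on each $\mathcal{R}$-class. Words are words over $X\cup X^{-1}$ for a finite generating set $X$. The prefix monoid of $S$ is the submonoid of $G$ which is the image under $\sigma$ of the $\mathcal{R}$-class of $1$ (equivalently, the submonoid generated by the elements represented by all prefixes of the relators $w_i$); its membership problem in $G$ asks whether a given word over $X\cup X^{-1}$ represents an element of it. Word metric: the Cayley graph of $S$ has vertex set $S$ and edges $s\xrightarrow{x}sx$ ($x\in X\cup X^{-1}$); its strongly connected components have the $\mathcal{R}$-classes as vertex sets. For $\mathcal{R}$-related $s,t$,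 $d_S(s,t)$ is the path distance in this component; otherwise $d_S(s,t)=\infty$. Put $l_S(s)=d_S(ss^{-1},s)$, and let $l_G$ be the word length on $G$ with respect to the image of $X$. $S$ has recursively bounded group distortion if (for the word lengths with respect to a fixed finite generating set of $S$ and the corresponding generating set of $G$) there is a recursive function $\phi\colon\mathbb{N}\to\mathbb{N}$ such that $l_S(s)\le\phi(l_G(\sigma(s)))$ for every $s\in S$. *)

(* Defs.v *)
From mathcomp Require Import all_boot.
From mathcomp Require Import monoid.
From mathcomp Require Import boolp.

Set Implicit Arguments.
Unset Strict Implicit.
Unset Printing Implicit Defensive.

Local Open Scope group_scope.

(* (x, false) is the letter x and (x, true) is the letter x^-1. *)
Definition letter (X : Type) : Type := (X * bool)%type.

Definition word (X : Type) : Type := seq (letter X).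

Definition winv (X : Type) (w : word X) : word X :=
  rev [seq (a.1, ~~ a.2) | a <- w].

Definition leval (X : Type) (M : starMonoidType) (gen : X -> M)
    (a : letter X) : M :=
  if a.2 then (gen a.1)^-1 else gen a.1.

Definition weval (X : Type) (M : starMonoidType) (gen : X -> M)
    (w : word X) : M :=
  \prod_(a <- w) leval gen a.

Definition generates (X : Type) (M : starMonoidType) (gen : X -> M) : Prop :=
  forall s : M, exists w : word X, weval gen w = s.

(* The laws (s^-1)^-1 = s and (st)^-1 = t^-1 s^-1 of a starMonoidType hold in
   every inverse monoid, so they restrict nothing. *)
Definition inverse_monoid (S : starMonoidType) : Prop :=
  forall s : S, unique (fun t => s * t * s = s /\ t * s * t = t) s^-1.

(* Equality in Inv<X | R>, on words.  The free inverse monoid is the quotient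
   of the words by the Vagner congruence, which is generated by the pairs
   inv_vagner1 and inv_vagner2. *)
Inductive inv_cong (X : Type) (R : word X -> word X -> Prop) :
    word X -> word X -> Prop :=
| inv_rel u v : R u v -> inv_cong R u v
| inv_vagner1 u : inv_cong R (u ++ winv u ++ u) u
| inv_vagner2 u v :
    inv_cong R (u ++ winv u ++ v ++ winv v) (v ++ winv v ++ u ++ winv u)
| inv_refl u : inv_cong R u u
| inv_sym u v : inv_cong R u v -> inv_cong R v u
| inv_trans u v w : inv_cong R u v -> inv_cong R v w -> inv_cong R u w
| inv_cat u u' v v' :
    inv_cong R u u' -> inv_cong R v v' -> inv_cong R (u ++ v) (u' ++ v').

(* S = Inv<X | R>, the generator x being interpreted as gen x. *)
Definition presented_by (S : starMonoidType) (X : Type) (gen : X -> S)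
    (R : word X -> word X -> Prop) : Prop :=
  generates gen /\
  forall u v : word X, weval gen u = weval gen v <-> inv_cong R u v.

Definition special (S : starMonoidType) : Prop :=
  exists (X : Type) (gen : X -> S) (R : word X -> word X -> Prop),
    (forall u v, R u v -> v = [::]) /\ presented_by gen R.

Definition R_related (S : starMonoidType) (s t : S) : Prop :=
  s * s^-1 = t * t^-1.

Inductive sigma_cong (S : starMonoidType) : S -> S -> Prop :=
| sigma_idem e f : e * e = e -> f * f = f -> sigma_cong e f
| sigma_refl s : sigma_cong s s
| sigma_sym s t : sigma_cong s t -> sigma_cong t s
| sigma_trans s t u : sigma_cong s t -> sigma_cong t u -> sigma_cong s u
| sigma_mul s s' t t' :
    sigma_cong s s' -> sigma_cong t t' -> sigma_cong (s * t) (s' * t').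

(* sigma : S -> G is, up to isomorphism, the quotient of S by sigma_cong. *)
Definition maximal_group_image (S : starMonoidType) (G : groupType)
    (sigma : S -> G) : Prop :=
  [/\ monoid_morphism sigma,
      forall g : G, exists s : S, sigma s = g
    & forall s t : S, sigma s = sigma t <-> sigma_cong s t].

Definition E_unitary (S : starMonoidType) (G : groupType) (sigma : S -> G) :
    Prop :=
  forall s t : S, R_related s t -> sigma s = sigma t -> s = t.

Definition prefix_monoid (S : starMonoidType) (G : groupType) (sigma : S -> G)
    (g : G) : Prop :=
  exists2 s : S, R_related s 1 & sigma s = g.

Definition least (P : nat -> Prop) (n : nat) : Prop :=
  P n /\ forall m, P m -> n <= m.

(* The edges of the Cayley graph that lie in a strongly connected component. *)
Definition component_edge (X : Type) (S : starMonoidType) (gen : X -> S)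
    (s t : S) : Prop :=
  R_related s t /\ exists a : letter X, t = s * leval gen a.

Inductive component_path (X : Type) (S : starMonoidType) (gen : X -> S) :
    S -> S -> nat -> Prop :=
| path_nil s : component_path gen s s 0
| path_step s t u n :
    component_edge gen s t -> component_path gen t u n ->
    component_path gen s u n.+1.

(* d_S(s, t) = n; no n satisfies this when s and t are not R-related, which
   is the case of an infinite distance. *)
Definition is_distance (X : Type) (S : starMonoidType) (gen : X -> S)
    (s t : S) (n : nat) : Prop :=
  least (component_path gen s t) n.

(* l_S(s) = n *)
Definition is_monoid_length (X : Type) (S : starMonoidType) (gen : X -> S)
    (s : S) (n : nat) : Prop :=
  is_distance gen (s * s^-1) s n.

(* l_G(g) = n *)
Definition is_group_length (X : Type) (G : groupType) (gen : X -> G)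
    (g : G) (n : nat) : Prop :=
  least (fun m => exists2 w : word X, weval gen w = g & size w = m) n.

(* The total functions recursive in the total function O: the least class
   containing O and the basic functions that is closed under composition,
   primitive recursion and minimization of regular functions.  By Kleene's
   normal form theorem these are the total functions computed by Turing
   machines with oracle O. *)
Inductive recursive_in (m : nat) (O : m.-tuple nat -> nat) :
    forall k : nat, (k.-tuple nat -> nat) -> Prop :=
| rec_oracle : recursive_in O O
| rec_zero k : recursive_in O (fun _ : k.-tuple nat => 0%N)
| rec_succ : recursive_in O (fun v : 1.-tuple nat => (thead v).+1)
| rec_proj k (i : 'I_k) : recursive_in O (fun v : k.-tuple nat => tnth v i)
| rec_comp k l (f : l.-tuple nat -> nat) (g : 'I_l -> k.-tuple nat -> nat) :
    recursive_in O f -> (forall i, recursive_in O (g i)) ->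
    recursive_in O (fun v : k.-tuple nat => f [tuple g i v | i < l])
| rec_primrec k (f : k.-tuple nat -> nat) (g : k.+2.-tuple nat -> nat)
    (h : k.+1.-tuple nat -> nat) :
    recursive_in O f -> recursive_in O g ->
    (forall v : k.-tuple nat, h [tuple of 0%N :: v] = f v) ->
    (forall n (v : k.-tuple nat), h [tuple of n.+1 :: v] =
                 g [tuple of n :: h [tuple of n :: v] :: v]) ->
    recursive_in O h
| rec_min k (g : k.+1.-tuple nat -> nat) (h : k.-tuple nat -> nat) :
    recursive_in O g ->
    (forall v : k.-tuple nat, g [tuple of h v :: v] = 0%N) ->
    (forall (v : k.-tuple nat) n, n < h v -> g [tuple of n :: v] <> 0%N) ->
    recursive_in O h.

Definition recursive (k : nat) (f : k.-tuple nat -> nat) : Prop :=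
  recursive_in (fun _ : 0.-tuple nat => 0%N) f.

Definition recursively_bounded_group_distortion (X : Type)
    (S : starMonoidType) (gen : X -> S) (G : groupType) (sigma : S -> G) :
    Prop :=
  exists2 phi : nat -> nat,
    recursive (fun v : 1.-tuple nat => phi (thead v))
  & forall (s : S) (m n : nat),
      is_monoid_length gen s m ->
      is_group_length (sigma \o gen) (sigma s) n ->
      m <= phi n.

Record problem (X : finType) := Problem {
  arity : nat;
  holds : arity.-tuple (word X) -> Prop
}.

(* Bijective numeration in base #|X ∪ X^-1|, first letter least significant. *)
Definition word_code (X : finType) (w : word X) : nat :=
  foldr (fun (a : letter X) c => (enum_rank a).+1 + #|{: X * bool}| * c)%N 0%N w.

Lemma word_code_inj (X : finType) : injective (@word_code X).
Proof.
elim=> [|a u IHu] [|b v] //= /eqP; rewrite !addSn eqSS => /eqP.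
set k := #|{: X * bool}| => E.
have rk (c : letter X) : enum_rank c < k by apply: ltn_ord.
have k0 : 0 < k by apply: leq_ltn_trans (rk a).
have := congr1 (modn^~ k) E; have := congr1 (divn^~ k) E.
rewrite /= ![(k * _)%N]mulnC !divnDMl // !(addnC (nat_of_ord _)) !modnMDl.
rewrite !modn_small ?divn_small ?add0n ?rk // => /IHu -> /ord_inj.
by move=> /enum_rank_inj ->.
Qed.

Definition char_fun (X : finType) (P : problem X)
    (v : (arity P).-tuple nat) : nat :=
  `[< exists2 t : (arity P).-tuple (word X),
        [tuple of map (@word_code X) t] = v & holds t >].

Definition decidable_problem (X : finType) (P : problem X) : Prop :=
  recursive (@char_fun X P).

Definition turing_reducible (X : finType) (P Q : problem X) : Prop :=
  recursive_in (@char_fun X Q) (@char_fun X P).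

Definition turing_equivalent (X : finType) (P Q : problem X) : Prop :=
  turing_reducible P Q /\ turing_reducible Q P.

Definition word_problem (X : finType) (M : starMonoidType) (gen : X -> M) :
    problem X :=
  @Problem X 2 (fun t =>
    weval gen (nth [::] t 0%N) = weval gen (nth [::] t 1%N)).

Definition identity_problem (X : finType) (M : starMonoidType) (gen : X -> M) :
    problem X :=
  @Problem X 1 (fun t => weval gen (thead t) = 1).

Definition R_class_of_one_problem (X : finType) (S : starMonoidType)
    (gen : X -> S) : problem X :=
  @Problem X 1 (fun t => R_related (weval gen (thead t)) 1).

Definition prefix_membership_problem (X : finType) (S : starMonoidType)
    (gen : X -> S) (G : groupType) (sigma : S -> G) : problem X :=
  @Problem X 1 (fun t => prefix_monoid sigma (weval (sigma \o gen) (thead t))).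

(* Main.v *)
Require Import Defs.
From mathcomp Require Import all_boot monoid.
From mathcomp Require Import boolp.
From Stdlib Require List.

(* A word over the presentation alphabet acts on every graph with
   deterministic, invertible letters in which the relators are loops at all
   vertices, and words equal in S act alike.  Gluing a second copy of the
   Schützenberger graph of 1 to the one of s by a single edge gives such a
   graph, and E-unitarity forbids that it stays unfolded: hence the
   Schützenberger graphs of S are induced subgraphs of the Cayley graph of G.
   The vertices of the graph of v are the elements x p, with x a prefix of v
   and p in the prefix monoid, so u = v in S iff u = v in G and the vertices on
   each of the two paths lie in the graph of the other word.  This reduces (1)
   to (4).  Bounded distortion bounds the length of a right invertible element
   above a given element of the prefix monoid, which reduces (4) to (3); the
   reductions of (3) to (2) and of (2) to (1) query u u^-1 = 1 and u = 1. *)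

Set Implicit Arguments.
Unset Strict Implicit.
Unset Printing Implicit Defensive.

(** * Words and inverse monoids *)

Section Words.
Local Open Scope group_scope.

Lemma weval_nil (X : Type) (M : starMonoidType) (gen : X -> M) :
  weval gen [::] = 1.
Proof. exact: big_nil. Qed.

Lemma weval_cons (X : Type) (M : starMonoidType) (gen : X -> M) a w :
  weval gen (a :: w) = leval gen a * weval gen w.
Proof. exact: big_cons. Qed.

Lemma weval_cat (X : Type) (M : starMonoidType) (gen : X -> M) u v :
  weval gen (u ++ v) = weval gen u * weval gen v.
Proof. exact: big_cat. Qed.

Lemma weval_seq1 (X : Type) (M : starMonoidType) (gen : X -> M) a :
  weval gen [:: a] = leval gen a.
Proof. exact: big_seq1. Qed.

Definition linv (X : Type) (a : letter X) : letter X := (a.1, ~~ a.2).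

Lemma linvK (X : Type) : involutive (@linv X).
Proof. by case=> x b; rewrite /linv /= negbK. Qed.

Lemma leval_linv (X : Type) (M : starMonoidType) (gen : X -> M) a :
  leval gen (linv a) = (leval gen a)^-1.
Proof. by case: a => x [] /=; rewrite /leval /= ?invgK. Qed.

Lemma winv_cons (X : Type) (a : letter X) w :
  winv (a :: w) = winv w ++ [:: linv a].
Proof. by rewrite /winv map_cons rev_cons -cats1. Qed.

Lemma winv_cat (X : Type) (u v : word X) : winv (u ++ v) = winv v ++ winv u.
Proof. by rewrite /winv map_cat rev_cat. Qed.

Lemma winvK (X : Type) : involutive (@winv X).
Proof.
elim=> // a w IHw; rewrite winv_cons winv_cat IHw.
by rewrite -[winv [:: _]]/[:: linv (linv a)] linvK.
Qed.

Lemma weval_winv (X : Type) (M : starMonoidType) (gen : X -> M) w :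
  weval gen (winv w) = (weval gen w)^-1.
Proof.
elim: w => [|a w IHw]; first by rewrite weval_nil invg1.
by rewrite winv_cons weval_cat IHw weval_seq1 leval_linv weval_cons invgM.
Qed.

End Words.

(** * Commuting idempotents, the relation R, and the map to G *)

Section InverseMonoid.
Local Open Scope group_scope.
Variable S : starMonoidType.
Hypothesis S_inverse : inverse_monoid S.
Implicit Types s t u e f : S.

Lemma mulgVM s : s * s^-1 * s = s.
Proof. by case: (proj1 (S_inverse s)). Qed.

Lemma idem_invg e : e * e = e -> e^-1 = e.
Proof. by move=> ee; apply: (proj2 (S_inverse e)); rewrite !ee. Qed.

Lemma idem_mulgV s : s * s^-1 * (s * s^-1) = s * s^-1.
Proof. by rewrite mulgA mulgVM. Qed.

Lemma idem_mulVg s : s^-1 * s * (s^-1 * s) = s^-1 * s.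
Proof. by have := idem_mulgV s^-1; rewrite invgK. Qed.

(** With [x] the inverse of [e * f], the element [f * x * e] is an inverse of [e * f] too, so it
    equals [x] by uniqueness. This makes [x] idempotent, hence its own inverse, and so
    [e * f = x]. *)
Lemma idem_mulg e f : e * e = e -> f * f = f -> e * f * (e * f) = e * f.
Proof.
move=> ee ff; set x := (e * f)^-1.
have [[efx xef] uniq_x] := S_inverse (e * f); rewrite -/x in efx xef uniq_x.
have fxe : x = f * x * e.
  apply: uniq_x; split.
    transitivity (e * (f * f) * x * (e * e) * f); first by rewrite !mulgA.
    by rewrite ee ff -[RHS]efx !mulgA.
  transitivity (f * (x * (e * e) * (f * f) * x) * e); first by rewrite !mulgA.
  by rewrite ee ff -[in RHS]xef !mulgA.
have xx : x * x = x.
  rewrite [in LHS]fxe; transitivity (f * (x * (e * f) * x) * e).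
    by rewrite !mulgA.
  by rewrite xef -fxe.
by have := idem_invg xx; rewrite /x invgK => ->; exact: xx.
Qed.

(** Being idempotent, [e * f] is its own inverse, which is [f * e] since inversion reverses
    products. *)
Lemma idem_comm e f : e * e = e -> f * f = f -> e * f = f * e.
Proof.
move=> ee ff; rewrite -(idem_invg (idem_mulg ee ff)) invgM.
by rewrite (idem_invg ee) (idem_invg ff).
Qed.

Lemma R_related_mul s t u : R_related s t -> R_related (u * s) (u * t).
Proof.
rewrite /R_related !invgM => st.
by rewrite -!mulgA (mulgA s) (mulgA t) st.
Qed.

Lemma R_related_mulr1 s t : R_related t 1 -> R_related (s * t) s.
Proof. by move=> /(R_related_mul s); rewrite mulg1. Qed.

(** A path of the Cayley graph that comes back to its R-class never left it: the idempotents
    [s * s^-1] can only decrease along a path, and here they agree at both ends. *)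
Lemma R_related_mulK s t u : R_related (s * t * u) s -> R_related (s * t) s.
Proof.
rewrite /R_related => H.
set e := s * t * (s * t)^-1.
have eu : e * (s * t * u) = s * t * u by rewrite mulgA mulgVM.
have es : e * (s * s^-1) = s * s^-1 by rewrite -H mulgA eu.
rewrite -[RHS]es idem_comm ?idem_mulgV //.
by rewrite /e !mulgA mulgVM.
Qed.

Lemma R_related_idem s : R_related (s * s^-1) s.
Proof. by rewrite /R_related invgM invgK idem_mulgV. Qed.

Lemma R_related_mulVK s t : R_related s t -> s * (s^-1 * t) = t.
Proof. by rewrite mulgA => ->; exact: mulgVM. Qed.

(** This lets inverse letters walk the edges of an R-class backwards. It comes from
    [s * t * (s * t)^-1 * s = s] by commuting [s^-1 * s] with [t * t^-1]. *)
Lemma R_related_mulKV s t : R_related (s * t) s -> s * t * t^-1 = s.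
Proof.
move=> /R_related_mulVK H; rewrite -[RHS]H invgM.
transitivity (s * ((s^-1 * s) * (t * t^-1))); first by rewrite !mulgA mulgVM.
by rewrite (idem_comm (idem_mulVg s) (idem_mulgV t)) !mulgA.
Qed.

(** With [e = s * s^-1] and [f = t * t^-1], the hypotheses become [e * f * e = e] and
    [f * e * f = f], that is, [e] and [f] lie below each other in the natural order. *)
Lemma R_related_antisym s t :
  R_related (s * s^-1 * t) s -> R_related (t * t^-1 * s) t -> R_related s t.
Proof.
have conj e u : e * e = e -> e * u * (e * u)^-1 = e * (u * u^-1) * e.
  by move=> ee; rewrite invgM (idem_invg ee) !mulgA.
have [ee ff] := (idem_mulgV s, idem_mulgV t).
rewrite /R_related !conj //; move: (s * _) (t * _) ee ff => e f ee ff.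
rewrite -mulgA (idem_comm ff ee) mulgA ee => ef.
by rewrite -mulgA ff ef.
Qed.

Variables (G : groupType) (sigma : S -> G).
Hypothesis sigma_morph : monoid_morphism sigma.

Lemma sigma1 : sigma 1 = 1.
Proof. by case: sigma_morph. Qed.

Lemma sigmaM s t : sigma (s * t) = sigma s * sigma t.
Proof. by case: sigma_morph. Qed.

Lemma sigma_idempotent e : e * e = e -> sigma e = 1.
Proof.
by move=> /(congr1 sigma); rewrite sigmaM => /(canRL (mulgK _)); rewrite mulgV.
Qed.

Lemma sigmaV s : sigma s^-1 = (sigma s)^-1.
Proof.
by apply/esym/mulg1_eq; rewrite -sigmaM sigma_idempotent // idem_mulgV.
Qed.

Lemma sigma_leval (X : Type) (gen : X -> S) a :
  leval (sigma \o gen) a = sigma (leval gen a).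
Proof. by rewrite /leval; case: a.2; rewrite /= ?sigmaV. Qed.

Lemma sigma_weval (X : Type) (gen : X -> S) w :
  weval (sigma \o gen) w = sigma (weval gen w).
Proof.
elim: w => [|a w IHw]; first by rewrite !weval_nil sigma1.
by rewrite !weval_cons IHw sigmaM sigma_leval.
Qed.

Hypothesis S_E_unitary : E_unitary sigma.

(** The R-related elements [s] and [s * s^-1] have the same image 1, so they coincide. *)
Lemma E_unitary_idem s : sigma s = 1 -> s * s = s.
Proof.
move=> s1; suff -> : s = s * s^-1 by exact: idem_mulgV.
apply: S_E_unitary; first by rewrite /R_related R_related_idem.
by rewrite s1 sigma_idempotent ?idem_mulgV.
Qed.

End InverseMonoid.

(** * Schützenberger graphs *)

Section InverseGraphs.
Local Open Scope group_scope.
Variables (X V : Type) (D : V -> Prop) (L : letter X -> V -> V -> Prop).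

Record inverse_graph : Prop := InverseGraph {
  edge_sym : forall a p q, L a p q -> L (linv a) q p;
  edge_det : forall a p q q', L a p q -> L a p q' -> q = q';
  edge_dom : forall a p q, L a p q -> D p
}.

(** The test [D p] makes the empty word act as the identity of [D] rather than of all of [V], so
    that a relator looping at every vertex acts exactly as it does. *)
Fixpoint run (w : word X) (p q : V) : Prop :=
  if w is a :: w' then exists2 r, L a p r & run w' r q else D p /\ p = q.

Hypothesis L_graph : inverse_graph.

Lemma run_dom w p q : run w p q -> D p.
Proof. by case: w => [[]//|a w] /= [r /(edge_dom L_graph)]. Qed.

Lemma run_cat u v p q :
  run (u ++ v) p q <-> exists2 r, run u p r & run v r q.
Proof.
elim: u p => [|a u IHu] p /=.
  split=> [pq | [r [_ ->]] //].
  by exists p => //; split=> //; apply: run_dom pq.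
split=> [[r ar /IHu[r' ur' vq]] | [r' [r ar ur'] vq]].
  by exists r' => //; exists r.
by exists r => //; apply/IHu; exists r'.
Qed.

Lemma run_det w p q q' : run w p q -> run w p q' -> q = q'.
Proof.
elim: w p => [|a w IHw] p /=; first by move=> [_ <-] [_ <-].
move=> [r ar rq] [r' ar' rq'].
by apply: IHw rq _; rewrite (edge_det L_graph ar ar').
Qed.

Lemma run_winv w p q : run w p q -> run (winv w) q p.
Proof.
elim: w p => [|a w IHw] p /=; first by case=> ? <-.
move=> [r ar /IHw rq]; rewrite winv_cons; apply/run_cat; exists r => //.
exists p; first exact: edge_sym.
by split=> //; apply: edge_dom L_graph _ _ _ ar.
Qed.

(** These words act as partial identities, and partial identities commute, as the second Vagner
    relation demands. *)
Lemma run_mulV w p q :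
  run (w ++ winv w) p q <-> p = q /\ exists r, run w p r.
Proof.
split=> [/run_cat[r wr rq] | [<- [r wr]]].
  by split; [apply: run_det (run_winv wr) rq | exists r].
by apply/run_cat; exists r => //; apply: run_winv.
Qed.

(** Words act as partial injections of the vertex set. These form an inverse monoid, so the Vagner
    relations hold for the action; the relators act as the identity by hypothesis. *)
Lemma run_cong (R : word X -> word X -> Prop) u v :
  (forall r r' p, R r r' -> r' = [::] /\ (D p -> run r p p)) ->
  inv_cong R u v -> forall p q, run u p q <-> run v p q.
Proof.
move=> RL; elim=> {u v}.
- move=> u v uv p q; have [-> loop] := RL _ _ p uv.
  split=> [pq | [Dp <-]]; last exact: loop.
  have Dp := run_dom pq; split=> //.
  by apply: run_det pq; apply: loop.
- move=> u p q; split=> [/run_cat[r ur /run_cat[r' rr' r'q]] | pq].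
    by rewrite (run_det (run_winv ur) rr').
  apply/run_cat; exists q => //; apply/run_cat; exists p => //.
  exact: run_winv.
- move=> u v p q; rewrite (catA u) (catA v (winv v)).
  split=> /run_cat[r /run_mulV[<- pr] /run_mulV[<- rq]].
    by apply/run_cat; exists p; apply/run_mulV.
  by apply/run_cat; exists p; apply/run_mulV.
- by [].
- by move=> u v _ IH p q; split=> /IH.
- by move=> u v w _ IH1 _ IH2 p q; split=> [/IH1/IH2 | /IH2/IH1].
move=> u u' v v' _ IHu _ IHv p q; split=> /run_cat[r /IHu ur /IHv rq];
by apply/run_cat; exists r.
Qed.

End InverseGraphs.

(** * Schützenberger graphs inside the Cayley graph of G *)

Section SpecialPresentation.
Local Open Scope group_scope.
Variables (S : starMonoidType) (X : Type) (gen : X -> S).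
Variable R : word X -> word X -> Prop.
Hypothesis S_inverse : inverse_monoid S.
Hypothesis R_special : forall u v, R u v -> v = [::].
Hypothesis S_presented : presented_by gen R.

Lemma relator_eval u v : R u v -> weval gen u = 1.
Proof.
move=> uv; rewrite -(weval_nil gen) -(R_special uv).
by apply/(proj2 S_presented)/inv_rel.
Qed.

Lemma run_weval (V : Type) (D : V -> Prop) (L : letter X -> V -> V -> Prop)
    u v :
  inverse_graph D L ->
  (forall w p, weval gen w = 1 -> D p -> run D L w p p) ->
  weval gen u = weval gen v -> forall p q, run D L u p q <-> run D L v p q.
Proof.
move=> L_graph loop /(proj2 S_presented); apply: run_cong => //.
move=> r r' p rr'; split; first exact: R_special rr'.
by apply: loop; apply: relator_eval rr'.
Qed.

(* The Schützenberger graph of s. *)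
Definition R_edge (s : S) (a : letter X) (r t : S) : Prop :=
  [/\ R_related r s, R_related t s & t = r * leval gen a].

Lemma R_edge_graph s : inverse_graph ((@R_related S)^~ s) (R_edge s).
Proof.
split=> [a r t [rs ts def_t] | a r t t' [_ _ ->] [_ _ ->] // | a r t []//].
split=> //; rewrite leval_linv def_t R_related_mulKV //.
by rewrite -def_t /R_related ts.
Qed.

(** Only the end of the path has to be in the R-class: by [R_related_mulK] the vertices in between
    are there as well. *)
Lemma run_R_edge s w r :
  R_related r s -> R_related (r * weval gen w) r ->
  run ((@R_related S)^~ s) (R_edge s) w r (r * weval gen w).
Proof.
elim: w r => [|a w IHw] r rs rw; first by rewrite weval_nil mulg1.
move: rw; rewrite weval_cons mulgA => rw; have ra := R_related_mulK S_inverse rw.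
have as_ : R_related (r * leval gen a) s by rewrite /R_related ra.
exists (r * leval gen a) => //.
by apply: IHw => //; rewrite /R_related rw.
Qed.

Variables (G : groupType) (sigma : S -> G).
Hypothesis sigma_morph : monoid_morphism sigma.
Hypothesis S_E_unitary : E_unitary sigma.

(** An R-class thus spans an induced subgraph of the Cayley graph of G. If [y] is right invertible,
    right multiplication by it stays in the R-class and E-unitarity applies. Otherwise, were the
    edge missing, the graphs of [s] and of 1 could be glued along a [y]-edge without any folding,
    and an idempotent of [S] would move a vertex. *)
Lemma R_class_induced (s t : S) (y : letter X) :
  R_related t s -> sigma t = sigma s * sigma (leval gen y) ->
  s * leval gen y = t.
Proof.
move=> ts def_t; apply: contrapT => not_edge.
have [y1 | not_y1] := pselect (R_related (leval gen y) 1).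
  apply/not_edge/S_E_unitary; last by rewrite sigmaM.
  by rewrite /R_related (R_related_mulr1 _ y1) ts.
pose D (p : bool * S) := R_related p.2 (if p.1 then 1 else s).
(* The graphs of s (false) and of 1 (true), joined by an edge (1, y, t). *)
pose L a (p q : bool * S) :=
  [\/ p.1 = q.1 /\ R_edge (if p.1 then 1 else s) a p.2 q.2,
      [/\ a = y, p = (true, 1) & q = (false, t)]
    | [/\ a = linv y, p = (false, t) & q = (true, 1)]].
have L_graph : inverse_graph D L.
  split.
  - move=> a p q [[pq apq] | [-> -> ->] | [-> -> ->]].
    + apply: Or31; rewrite -pq; split=> //.
      exact: edge_sym (R_edge_graph _) _ _ _ apq.
    + exact: Or33.
    + by apply: Or32; rewrite linvK.
  (* Only the new edge could break determinism. No other [y]-edge leaves 1, as [y] is not right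
     invertible; no other one enters [t], as by E-unitarity it would start at [s]. *)
  - have no_y q : L y (true, 1) q -> q = (false, t).
      case=> [[_ [_ y1 q_y]] | [] // | []//].
      by case: not_y1; rewrite -[leval _ _]mul1g -q_y.
    have no_y' q : L (linv y) (false, t) q -> q = (true, 1).
      case=> [[_ [_ qs q_y]] | [] // | []//].
      rewrite /= in qs q_y; case: not_edge.
      have qs' : q.2 = s.
        apply: S_E_unitary => //.
        by rewrite q_y sigmaM // leval_linv sigmaV // def_t mulgK.
      rewrite -qs' q_y leval_linv -{2}[leval gen y]invgK R_related_mulKV //.
      by rewrite -leval_linv -q_y /R_related ts.
    move=> a p q q' [[pq apq] | [-> -> ->] | [-> -> ->]].
    + case=> [[pq' apq'] | [def_a def_p ->] | [def_a def_p ->]].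
      * case: q q' pq pq' apq apq' => [_ r] [_ r'] /= <- <- apq apq'.
        by rewrite (edge_det (R_edge_graph _) apq apq').
      * by apply: no_y; rewrite -def_a -def_p; apply: Or31.
      * by apply: no_y'; rewrite -def_a -def_p; apply: Or31.
    + by move/no_y.
    + by move/no_y'.
  - move=> a p q [[_ [rs _ _]] | [_ -> _] | [_ -> _]] //.
pose s_ (c : bool) : S := if c then 1 else s.
have runL c w r t' : run ((@R_related S)^~ (s_ c)) (R_edge (s_ c)) w r t' ->
    run D L w (c, r) (c, t').
  elim: w r => [|a w IHw] r /=; first by case=> Dr <-.
  case=> r' ar /IHw r't.
  by exists (c, r') => //; apply: Or31.
have loop w p : weval gen w = 1 -> D p -> run D L w p p.
  case: p => c r w1 Dr; apply: runL; have := @run_R_edge (s_ c) w r Dr.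
  by rewrite w1 mulg1; apply.
have [c def_c] := proj1 S_presented (s^-1 * t).
have sc : s * weval gen c = t.
  by rewrite def_c R_related_mulVK // /R_related ts.
(* This word is trivial in G, hence idempotent in [S], and yet it leads from one copy into the
   other. *)
pose w := c ++ [:: linv y].
have run_w : run D L w (false, s) (true, 1).
  apply/(run_cat L_graph); exists (false, t).
    rewrite -sc; apply: runL; apply: run_R_edge => //.
    by rewrite sc.
  by exists (true, 1); [exact: Or33 | split].
have ww : weval gen w * weval gen w = weval gen w.
  apply: (E_unitary_idem S_inverse sigma_morph S_E_unitary).
  rewrite weval_cat def_c weval_seq1 leval_linv !(sigmaM sigma_morph).
  rewrite !(sigmaV S_inverse sigma_morph).
  by rewrite def_t mulKg mulgV.
have /(_ (false, s) (true, 1)) [_ /(_ run_w)] : forall p q,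
    run D L (w ++ w) p q <-> run D L w p q.
  by apply: run_weval => //; rewrite weval_cat.
(* Since [w] and [w ++ w] act alike, [w] sends both [(false, s)] and [(true, 1)] to [(true, 1)],
   although it acts injectively. *)
case/(run_cat L_graph) => r run_r run_r1.
have def_r := run_det L_graph run_w run_r; rewrite -{r}def_r in run_r run_r1.
have run_V : run D L (winv w) (true, 1) (true, 1) := run_winv L_graph run_r1.
have := run_det L_graph run_V (run_winv L_graph run_w).
by [].
Qed.

Definition left_factor (p w : word X) : Prop := exists q, w = p ++ q.

(* As a subset of G, the vertex set of the Schützenberger graph of v. *)
Definition near_path (v : word X) (g : G) : Prop :=
  exists2 p, left_factor p v &
    prefix_monoid sigma ((sigma (weval gen p))^-1 * g).

Lemma near_pathM v g s :
  near_path v g -> R_related s 1 -> near_path v (g * sigma s).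
Proof.
move=> [p pv [r r1 def_r]] s1; exists p => //.
exists (r * s); first by rewrite /R_related (R_related_mulr1 _ s1).
by rewrite sigmaM // def_r mulgA.
Qed.

Definition path_edge (v : word X) (a : letter X) (g h : G) : Prop :=
  [/\ near_path v g, near_path v h & h = g * sigma (leval gen a)].

Lemma path_edge_graph v : inverse_graph (near_path v) (path_edge v).
Proof.
split=> [a g h [vg vh def_h] | a g h h' [_ _ ->] [_ _ ->] // | a g h []//].
by split=> //; rewrite def_h leval_linv sigmaV // mulgK.
Qed.

Lemma run_path_edge v w g h :
  run (near_path v) (path_edge v) w g h ->
  near_path v h /\ h = g * sigma (weval gen w).
Proof.
elim: w g => [|a w IHw] g /=.
  by case=> vg <-; rewrite weval_nil sigma1 // mulg1.
case=> r [_ _ ->] /IHw[vh def_h]; split=> //; rewrite {}def_h.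
by rewrite weval_cons sigmaM // mulgA.
Qed.

Lemma run_near_path v w g :
  (forall p, left_factor p w -> near_path v (g * sigma (weval gen p))) ->
  run (near_path v) (path_edge v) w g (g * sigma (weval gen w)).
Proof.
elim: w g => [|a w IHw] g vw.
  rewrite weval_nil sigma1 // mulg1; split=> //.
  have := vw [::]; rewrite weval_nil sigma1 // mulg1; apply.
  by exists [::].
have va : near_path v (g * sigma (leval gen a)).
  by rewrite -(weval_seq1 gen); apply: vw; exists w.
exists (g * sigma (leval gen a)).
  split=> //; have := vw [::]; rewrite weval_nil sigma1 // mulg1; apply.
  by exists (a :: w).
rewrite weval_cons sigmaM // mulgA; apply: IHw => p [q def_w].
rewrite -mulgA -sigmaM // -weval_cons; apply: vw; exists q.
by rewrite def_w.
Qed.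

Lemma left_factor_R1 p w :
  left_factor p w -> weval gen w = 1 -> R_related (weval gen p) 1.
Proof.
move=> [q ->]; rewrite weval_cat -[weval gen p]mul1g => pq.
by apply: (@R_related_mulK S S_inverse 1 (weval gen p) (weval gen q)); rewrite pq.
Qed.

(** A word equal to 1 has all its prefixes in the R-class of 1, so it loops in the graph on
    [near_path v], and words equal in [S] act alike there. As [v ++ winv v] runs from 1 to 1, so
    does [c ++ winv c] for any word [c] representing [t]; hence the path of [c] ends at a vertex. *)
Lemma R_class_near_path v t :
  R_related t (weval gen v) -> near_path v (sigma t).
Proof.
have [c <-] := proj1 S_presented t; rewrite /R_related => cv.
have one_v g p : left_factor p v -> g = sigma (weval gen p) -> near_path v g.
  move=> pv ->; exists p => //; exists 1; rewrite ?sigma1 ?mulVg //.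
have v_graph := path_edge_graph v.
have loop w g : weval gen w = 1 -> near_path v g ->
    run (near_path v) (path_edge v) w g g.
  move=> w1 vg; rewrite -{2}[g]mulg1 -(sigma1 sigma_morph) -w1.
  apply: run_near_path => p pw; apply: near_pathM => //.
  exact: left_factor_R1 pw w1.
have run_v : run (near_path v) (path_edge v) (v ++ winv v) 1 1.
  apply/(run_mulV v_graph); split=> //; exists (1 * sigma (weval gen v)).
  by apply: run_near_path => p pv; apply: one_v pv _; rewrite mul1g.
have /(_ 1 1)[_ /(_ run_v)] : forall p q,
    run (near_path v) (path_edge v) (c ++ winv c) p q <->
    run (near_path v) (path_edge v) (v ++ winv v) p q.
  by apply: run_weval => //; rewrite !weval_cat !weval_winv cv.
case/(run_mulV v_graph) => _ [r /run_path_edge[vr def_r]].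
by rewrite -[sigma _]mul1g -def_r.
Qed.

(** The path of [v] from [s * s^-1] ends at [s], so its prefix [p] stays in the R-class of [s], and
    the right invertible factor [r] does not leave it. *)
Lemma near_path_R_class v g :
  near_path v g -> exists2 t, R_related t (weval gen v) & sigma t = g.
Proof.
move=> [p [q def_v] [r r1 def_r]]; set s := weval gen v.
exists (s * s^-1 * weval gen p * r); last first.
  by rewrite !sigmaM // def_r sigmaV // mulgV mul1g mulVKg.
rewrite /R_related (R_related_mulr1 _ r1) -[in RHS](R_related_idem S_inverse s).
apply: (@R_related_mulK _ S_inverse (s * s^-1) _ (weval gen q)).
rewrite -mulgA -weval_cat -def_v -/s (mulgVM S_inverse).
by rewrite /R_related R_related_idem.
Qed.

(** The path of [u] from [s * s^-1] is followed letter by letter: each next vertex lies in the image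
    of the R-class, and then [R_class_induced] supplies the edge. *)
Lemma near_path_R_related u v :
  (forall p, left_factor p u -> near_path v (sigma (weval gen p))) ->
  R_related (weval gen v * (weval gen v)^-1 * weval gen u) (weval gen v).
Proof.
set s := weval gen v => vu.
have sV : sigma (s * s^-1) = 1 by rewrite sigma_idempotent ?idem_mulgV.
elim/last_ind: u vu => [|u a IHu] vu.
  by rewrite weval_nil mulg1 /R_related R_related_idem.
have {}IHu : R_related (s * s^-1 * weval gen u) s.
  by apply: IHu => p [q def_u]; apply: vu; exists (rcons q a); rewrite def_u rcons_cat.
have [|t ts def_t] := @near_path_R_class v (sigma (weval gen (rcons u a))).
  by apply: vu; exists [::]; rewrite cats0.
rewrite -cats1 weval_cat weval_seq1 mulgA (@R_class_induced _ t) //.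
  by rewrite /R_related ts.
by rewrite def_t -cats1 weval_cat weval_seq1 !(sigmaM _ (_ * _)) // sV mul1g sigmaM.
Qed.

(** By E-unitarity, [u = v] in [S] means equality in G together with R-relatedness, and the latter
    holds as soon as each path can be traced in the graph of the other word. *)
Lemma eq_weval_near_path u v :
  weval gen u = weval gen v <->
  [/\ sigma (weval gen u) = sigma (weval gen v),
      forall p, left_factor p u -> near_path v (sigma (weval gen p))
    & forall p, left_factor p v -> near_path u (sigma (weval gen p))].
Proof.
split=> [uv | [uv near_u near_v]]; last first.
  apply: S_E_unitary => //.
  by apply: (R_related_antisym S_inverse); apply: near_path_R_related.
have near_uv u1 v1 p : weval gen u1 = weval gen v1 -> left_factor p u1 ->
    near_path v1 (sigma (weval gen p)).
  move=> uv1 [q def_u1]; set s := weval gen v1.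
  (* The prefix [p] itself may lie in another R-class; multiplying by [s * s^-1] moves it into that
     of [s] without changing its image in G. *)
  have -> : sigma (weval gen p) = sigma (s * s^-1 * weval gen p).
    by rewrite sigmaM // (sigma_idempotent sigma_morph (idem_mulgV S_inverse s)) mul1g.
  apply: R_class_near_path; rewrite -/s /R_related -[in RHS](R_related_idem S_inverse s).
  apply: (@R_related_mulK _ S_inverse (s * s^-1) _ (weval gen q)).
  rewrite -mulgA -weval_cat -def_u1 uv1 -/s (mulgVM S_inverse).
  by rewrite /R_related R_related_idem.
by split=> [|p|p]; [rewrite uv | apply: near_uv | apply: near_uv].
Qed.

End SpecialPresentation.

(* The prefixes of a word over the presentation alphabet Y are represented over
   X by a prefix followed by one of finitely many words (Q a l). *)
Definition extended_prefix (X : Type) (Q : letter X -> nat -> word X)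
    (u : word X) (i l : nat) : word X :=
  take i u ++ (if drop i u is a :: _ then Q a l else [::]).

(** * From the given generators to the alphabet of the presentation *)

Section ChangeOfAlphabet.
Variables (S : starMonoidType) (X Y : Type) (gen : X -> S) (genY : Y -> S).
Variables (f : letter X -> word Y) (Q : letter X -> nat -> word X) (N : nat).
Hypothesis eval_f : forall a, weval genY (f a) = leval gen a.
Hypothesis eval_Q : forall a l, weval gen (Q a l) = weval genY (take l (f a)).
Hypothesis size_f : forall a, size (f a) <= N.

Lemma weval_flatten u : weval genY (flatten [seq f a | a <- u]) = weval gen u.
Proof.
by elim: u => [|a u IHu]; rewrite ?weval_nil //= weval_cat IHu eval_f weval_cons.
Qed.

(** Here [i] counts the blocks [f a] before the one in which [p] ends, and [l] is the length of the
    part of [p] inside that block. *)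
Lemma left_factor_extended_prefix u p :
  left_factor p (flatten [seq f a | a <- u]) ->
  exists i l, [/\ i <= size u, l <= N &
    weval gen (extended_prefix Q u i l) = weval genY p].
Proof.
elim: u p => [|a u IHu] p [q] /=.
  by case: p => // _; exists 0, 0; rewrite !weval_nil.
move=> def_fu; have [le_p | lt_p] := leqP (size p) (size (f a)).
  exists 0, (size p); split=> //; first exact: leq_trans (size_f a).
  rewrite /extended_prefix /= eval_Q; congr (weval _ _).
  by rewrite -(takel_cat (flatten [seq f b | b <- u]) le_p) def_fu take_size_cat.
have def_p : p = f a ++ drop (size (f a)) p.
  have := congr1 (take (size (f a))) def_fu.
  by rewrite take_size_cat // takel_cat 1?ltnW // => fa; rewrite {1}fa cat_take_drop.
have [|i [l [le_i le_l def_p']]] := IHu (drop (size (f a)) p).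
  exists q; have := congr1 (drop (size (f a))) def_fu.
  by rewrite drop_size_cat // {1}def_p -catA drop_size_cat.
exists i.+1, l; split=> //; rewrite def_p weval_cat -def_p'.
by rewrite /extended_prefix /= weval_cons eval_f.
Qed.

Lemma extended_prefix_left_factor u i l :
  exists2 p, left_factor p (flatten [seq f a | a <- u]) &
    weval genY p = weval gen (extended_prefix Q u i l).
Proof.
rewrite /extended_prefix; elim: u i => [|a u IHu] i /=.
  by exists [::]; [exists [::] | rewrite !weval_nil].
case: i => [|i] /=.
  exists (take l (f a)); last by rewrite eval_Q.
  by exists (drop l (f a) ++ flatten [seq f b | b <- u]); rewrite catA cat_take_drop.
have [p [q ->] def_p] := IHu i; exists (f a ++ p).
  by exists q; rewrite catA.
by rewrite weval_cat weval_cons def_p eval_f.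
Qed.
End ChangeOfAlphabet.

(** * A finite criterion for equality in S *)

Section WordProblemCriterion.
Local Open Scope group_scope.
Variables (S : starMonoidType) (X : finType) (gen : X -> S).
Variables (G : groupType) (sigma : S -> G).
Hypothesis S_inverse : inverse_monoid S.
Hypothesis S_generated : generates gen.
Hypothesis S_special : special S.
Hypothesis sigma_morph : monoid_morphism sigma.
Hypothesis S_E_unitary : E_unitary sigma.

(** [Q] and [N] are chosen once for all words, so that a reduction can store them. The bounds [m]
    and [n] may exceed the lengths, as [take] and [drop] saturate; the reduction uses the codes of
    the words as bounds. *)
Lemma eq_weval_extended_prefix :
  exists (Q : letter X -> nat -> word X) (N : nat), forall u v m n,
    (size u <= m)%N -> (size v <= n)%N ->
    let near m n u v := forall i l, (i <= m)%N -> (l <= N)%N ->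
      exists j k, [/\ (j <= n)%N, (k <= N)%N &
        prefix_monoid sigma (weval (sigma \o gen)
          (winv (extended_prefix Q v j k) ++ extended_prefix Q u i l))] in
    weval gen u = weval gen v <->
    [/\ weval (sigma \o gen) u = weval (sigma \o gen) v,
        near m n u v & near n m v u].
Proof.
have [Y [genY [R [R_special S_presented]]]] := S_special.
have [f eval_f] := choice (fun a : letter X => proj1 S_presented (leval gen a)).
have [Q' eval_Q'] :=
  choice (fun al : letter X * nat => S_generated (weval genY (take al.2 (f al.1)))).
pose Q a l := Q' (a, l); pose N := (\max_a size (f a))%N.
have eval_Q a l : weval gen (Q a l) = weval genY (take l (f a)) by apply: eval_Q'.
have size_f a : (size (f a) <= N)%N.
  exact: (leq_bigmax (F := fun a => size (f a)) a).
exists Q, N => u v m n.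
have sw := sigma_weval S_inverse sigma_morph.
pose fl (w : word X) := flatten [seq f a | a <- w].
have sQ w w' i l j k p q:
    weval genY p = weval gen (extended_prefix Q w i l) ->
    weval genY q = weval gen (extended_prefix Q w' j k) ->
    weval (sigma \o gen)
      (winv (extended_prefix Q w' j k) ++ extended_prefix Q w i l) =
    (sigma (weval genY q))^-1 * sigma (weval genY p).
  by move=> def_p def_q; rewrite weval_cat weval_winv !sw def_p def_q.
have near_pathP w w' m' n' : (size w <= m')%N -> (size w' <= n')%N ->
    (forall p, left_factor p (fl w) ->
       near_path genY sigma (fl w') (sigma (weval genY p))) <->
    (forall i l, (i <= m')%N -> (l <= N)%N ->
      exists j k, [/\ (j <= n')%N, (k <= N)%N &
        prefix_monoid sigma (weval (sigma \o gen)
          (winv (extended_prefix Q w' j k) ++ extended_prefix Q w i l))]).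
  move=> le_m le_n; split=> [near_w i l _ _ | near_w p].
    have [p /near_w[q qw' near_q] def_p] :=
      extended_prefix_left_factor eval_f eval_Q w i l.
    have [j [k [le_j le_k def_q]]] :=
      left_factor_extended_prefix eval_f eval_Q size_f qw'.
    exists j, k; split=> //; first exact: leq_trans le_n.
    by rewrite (sQ _ _ _ _ _ _ p q) ?def_q.
  case/(left_factor_extended_prefix eval_f eval_Q size_f) => i [l [le_i le_l def_p]].
  have [j [k [_ _ near_p]]] := near_w i l (leq_trans le_i le_m) le_l.
  have [q qw' def_q] := extended_prefix_left_factor eval_f eval_Q w' j k.
  by exists q => //; rewrite -(sQ w w' i l j k p q).
move=> le_m le_n /=; rewrite -!(weval_flatten eval_f) -/(fl u) -/(fl v).
rewrite (eq_weval_near_path S_inverse R_special S_presented sigma_morph S_E_unitary).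
rewrite !(weval_flatten eval_f) !sw.
have Pu := near_pathP u v m n le_m le_n; have Pv := near_pathP v u n m le_n le_m.
by split=> -[uv /Pu near_u /Pv near_v].
Qed.

End WordProblemCriterion.

(** * Relative recursiveness *)

Lemma recursive_in_trans m (O : m.-tuple nat -> nat) m' (O' : m'.-tuple nat -> nat)
    k (f : k.-tuple nat -> nat) :
  recursive_in O' O -> recursive_in O f -> recursive_in O' f.
Proof.
move=> OO'; elim=> {k f}.
- exact: OO'.
- exact: rec_zero.
- exact: rec_succ.
- exact: rec_proj.
- by move=> k l f g _ IHf _ IHg; apply: rec_comp.
- by move=> k f g h _ IHf _ IHg h0 hS; apply: rec_primrec IHf IHg h0 hS.
by move=> k g h _ IHg h0 h_min; apply: rec_min IHg h0 h_min.
Qed.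

Lemma recursive_recursive_in m (O : m.-tuple nat -> nat) k (f : k.-tuple nat -> nat) :
  recursive f -> recursive_in O f.
Proof. by apply: recursive_in_trans; apply: rec_zero. Qed.

Section Environments.
Variables (m : nat) (O : m.-tuple nat -> nat).

(* Functions of an environment (x_0, x_1, ...), the variables beyond its end
   being 0; this frees compositions from bookkeeping of arities. *)
Definition computable (F : seq nat -> nat) : Prop :=
  forall k, recursive_in O (fun v : k.-tuple nat => F v).

Lemma recursive_in_eq k (f g : k.-tuple nat -> nat) :
  f =1 g -> recursive_in O f -> recursive_in O g.
Proof. by move=> /funext->. Qed.

Lemma computable_eq F F' : F =1 F' -> computable F -> computable F'.
Proof. by move=> /funext->. Qed.

Lemma computable_var i : computable (nth 0 ^~ i).
Proof.
move=> k; have [le_ki | lt_ik] := leqP k i.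
  by apply: recursive_in_eq (rec_zero O k) => v; rewrite nth_default ?size_tuple.
apply: recursive_in_eq (rec_proj O (Ordinal lt_ik)) => v.
by rewrite (tnth_nth 0).
Qed.

Lemma computable_tuple k (f : k.-tuple nat -> nat) (Gs : 'I_k -> seq nat -> nat) :
  recursive_in O f -> (forall i, computable (Gs i)) ->
  computable (fun e => f [tuple Gs i e | i < k]).
Proof.
move=> Of cG l.
exact: (rec_comp (g := fun i (v : l.-tuple nat) => Gs i v) Of (fun i => cG i l)).
Qed.

Lemma recursive_in_subst k F (Gs : seq (seq nat -> nat)) :
  computable F -> (forall G, List.In G Gs ->
    recursive_in O (fun v : k.-tuple nat => G v)) ->
  recursive_in O (fun v : k.-tuple nat => F [seq G v | G : seq nat -> nat <- Gs]).
Proof.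
move=> cF cGs; set G0 := fun _ : seq nat => 0.
have cG (i : 'I_(size Gs)) : recursive_in O (fun v : k.-tuple nat => nth G0 Gs i v).
  apply: cGs; elim: Gs i {cF} => [|G Gs IH] [i lt_i] //=.
  case: i lt_i => [|i] lt_i /=; [by left | right].
  exact: (IH (Ordinal (lt_i : i < size Gs))).
apply: recursive_in_eq (rec_comp (cF (size Gs)) cG) => v; congr F.
apply: (@eq_from_nth _ 0); rewrite size_tuple ?size_map // => i lt_i.
by rewrite (nth_map G0) // -[i]/(nat_of_ord (Ordinal lt_i)) -tnth_nth tnth_mktuple.
Qed.

Lemma computable_subst F (Gs : seq (seq nat -> nat)) :
  computable F -> (forall G, List.In G Gs -> computable G) ->
  computable (fun e => F [seq G e | G : seq nat -> nat <- Gs]).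
Proof. by move=> cF cGs k; apply: recursive_in_subst => // G /cGs. Qed.

Definition computable1 (f : nat -> nat) : Prop :=
  computable (fun e => f (nth 0 e 0)).

Definition computable2 (f : nat -> nat -> nat) : Prop :=
  computable (fun e => f (nth 0 e 0) (nth 0 e 1)).

Definition computable3 (f : nat -> nat -> nat -> nat) : Prop :=
  computable (fun e => f (nth 0 e 0) (nth 0 e 1) (nth 0 e 2)).

Lemma computable_app1 f F : computable1 f -> computable F ->
  computable (fun e => f (F e)).
Proof. by move=> cf cF; apply: (computable_subst (Gs := [:: F]) cf) => G [<-|[]]. Qed.

Lemma computable_app2 f F1 F2 : computable2 f -> computable F1 -> computable F2 ->
  computable (fun e => f (F1 e) (F2 e)).
Proof.
move=> cf cF1 cF2.
by apply: (computable_subst (Gs := [:: F1; F2]) cf) => G [<-|[<-|[]]].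
Qed.

Lemma computable_app3 f F1 F2 F3 : computable3 f ->
  computable F1 -> computable F2 -> computable F3 ->
  computable (fun e => f (F1 e) (F2 e) (F3 e)).
Proof.
move=> cf cF1 cF2 cF3.
by apply: (computable_subst (Gs := [:: F1; F2; F3]) cf) => G [<-|[<-|[<-|[]]]].
Qed.

Definition vars d k : seq (seq nat -> nat) := [seq (nth 0 ^~ i) | i <- iota d (k - d)].

Lemma vars_drop d k (v : k.-tuple nat) :
  [seq G v | G : seq nat -> nat <- vars d k] = drop d v.
Proof.
rewrite -map_comp; apply: (@eq_from_nth _ 0).
  by rewrite size_map size_iota size_drop size_tuple.
move=> i; rewrite size_map size_iota => lt_i.
by rewrite (nth_map 0) ?size_iota //= nth_iota // nth_drop.
Qed.

Lemma computable_vars d k G : List.In G (vars d k) -> computable G.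
Proof.
by rewrite /vars; elim: (iota _ _) => //= i s IHs [<- | /IHs //]; apply: computable_var.
Qed.

Lemma computable_shift F d : computable F -> computable (fun e => F (drop d e)).
Proof.
move=> cF k.
apply: recursive_in_eq (recursive_in_subst (Gs := vars d k) (k := k) cF _) => [v|G].
  by rewrite vars_drop.
by move/computable_vars.
Qed.

Lemma computable_cons F G d : computable F -> computable G ->
  computable (fun e => F (G e :: drop d e)).
Proof.
move=> cF cG k.
apply: recursive_in_eq (recursive_in_subst (Gs := G :: vars d k) (k := k) cF _) => [v|G'].
  by rewrite /= vars_drop.
by case=> [<- | /computable_vars].
Qed.

Lemma computable_succ : computable1 succn.
Proof.
move=> k; apply: recursive_in_eq (rec_comp (rec_succ O) (fun _ => computable_var 0 k)) => v.
by rewrite /thead tnth_mktuple.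
Qed.

Lemma computable_const c : computable (fun=> c).
Proof.
elim: c => [|c IHc]; first by move=> k; apply: rec_zero.
exact: computable_app1 computable_succ IHc.
Qed.

(** The recursion runs on the first variable of an environment whose tail holds the parameters, and
    [N] is then substituted for that variable. The step reads the counter, the accumulated value and
    the parameters, in this order. *)
Lemma computable_natrec B (F : nat -> nat -> seq nat -> nat) N :
  computable B -> computable N ->
  computable (fun e => F (nth 0 e 0) (nth 0 e 1) (drop 2 e)) ->
  computable (fun e => nat_rect (fun=> nat) (B e) (fun n a => F n a e) (N e)).
Proof.
move=> cB cN cF.
have cR : computable (fun e =>
    nat_rect (fun=> nat) (B (behead e)) (fun n a => F n a (behead e)) (nth 0 e 0)).
  case=> [|k].
    (* In the empty environment the counter reads 0, so the value is the constant [B [::]]. *)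
    apply: recursive_in_eq (computable_const (B [::]) 0) => v.
    by rewrite (tuple0 v).
  refine (rec_primrec (cB k) (cF k.+2) _ _) => [v|n v] /=; by rewrite ?drop0.
apply: computable_eq (computable_cons 0 cR cN) => e.
by rewrite drop0.
Qed.

Lemma computable_pred : computable1 predn.
Proof.
apply: computable_eq (computable_natrec (B := fun=> 0)
  (F := fun n _ _ => n) (N := nth 0 ^~ 0) _ _ _); last exact: computable_var.
- by move=> e; case: (nth 0 e 0).
- exact: computable_const.
- exact: computable_var.
Qed.

Lemma computable_add : computable2 addn.
Proof.
apply: computable_eq (computable_natrec (B := nth 0 ^~ 1)
  (F := fun _ a _ => a.+1) (N := nth 0 ^~ 0) _ _ _).
- by move=> e; elim: (nth 0 e 0) => //= n ->.
- exact: computable_var.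
- exact: computable_var.
exact: computable_app1 computable_succ (computable_var 1).
Qed.

Lemma computable_sub : computable2 subn.
Proof.
apply: computable_eq (computable_natrec (B := nth 0 ^~ 0)
  (F := fun _ a _ => a.-1) (N := nth 0 ^~ 1) _ _ _).
- by move=> e; elim: (nth 0 e 1) => [|n /= ->]; rewrite ?subn0 ?subnS.
- exact: computable_var.
- exact: computable_var.
exact: computable_app1 computable_pred (computable_var 1).
Qed.

Lemma computable_mul : computable2 muln.
Proof.
apply: computable_eq (computable_natrec (B := fun=> 0)
  (F := fun _ a e => nth 0 e 1 + a) (N := nth 0 ^~ 0) _ _ _).
- by move=> e; elim: (nth 0 e 0) => //= n ->; rewrite mulSn.
- exact: computable_const.
- exact: computable_var.
apply: computable_app2 computable_add _ (computable_var 1).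
exact: computable_shift (computable_var 1).
Qed.

Definition computable_pred_env (p : seq nat -> bool) : Prop :=
  computable (fun e => nat_of_bool (p e)).

Lemma computable_leq F G : computable F -> computable G ->
  computable (fun e => F e <= G e).
Proof.
move=> cF cG.
apply: computable_eq (computable_app2 computable_sub (computable_const 1)
  (computable_app2 computable_sub cF cG)) => e.
by rewrite /leq; case: (F e - G e).
Qed.

Lemma computable_andb p q : computable_pred_env p -> computable_pred_env q ->
  computable_pred_env (fun e => p e && q e).
Proof.
move=> cp cq; apply: computable_eq (computable_app2 computable_mul cp cq) => e.
by rewrite mulnb.
Qed.

Lemma computable_negb p :
  computable_pred_env p -> computable_pred_env (fun e => ~~ p e).
Proof.
move=> cp.
apply: computable_eq (computable_app2 computable_sub (computable_const 1) cp) => e.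
by case: (p e).
Qed.

Lemma computable_eqn F G : computable F -> computable G ->
  computable_pred_env (fun e => F e == G e).
Proof.
move=> cF cG.
apply: computable_eq (computable_andb (computable_leq cF cG) (computable_leq cG cF)) => e.
by rewrite eqn_leq.
Qed.

Lemma computable_if p F G : computable_pred_env p -> computable F -> computable G ->
  computable (fun e => if p e then F e else G e).
Proof.
move=> cp cF cG; apply: computable_eq (computable_app2 computable_add
  (computable_app2 computable_mul cp cF)
  (computable_app2 computable_mul (computable_negb cp) cG)) => e.
by case: (p e); rewrite ?mul1n ?mul0n ?addn0.
Qed.

(** The bound variable is pushed on the front of the environment, so each nested quantifier shifts
    the outer variables by one. *)
Lemma computable_all (p : nat -> seq nat -> bool) N :
  computable N -> computable_pred_env (fun e => p (nth 0 e 0) (drop 1 e)) ->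
  computable_pred_env (fun e => all (p ^~ e) (iota 0 (N e))).
Proof.
move=> cN cp.
apply: computable_eq (computable_natrec (B := fun=> 1)
  (F := fun n a e => a * p n e) _ cN _).
- move=> e; elim: (N e) => // n IHn.
  have -> : iota 0 n.+1 = rcons (iota 0 n) n by rewrite -cats1 -addn1 iotaD.
  by rewrite all_rcons andbC -mulnb -IHn.
- exact: computable_const.
apply: computable_app2 computable_mul (computable_var 1) _.
(* The accumulated product, in position 1, is removed before the test is made. *)
by apply: computable_eq (computable_cons 2 cp (computable_var 0)) => e /=; rewrite drop0.
Qed.

Lemma computable_has (p : nat -> seq nat -> bool) N :
  computable N -> computable_pred_env (fun e => p (nth 0 e 0) (drop 1 e)) ->
  computable_pred_env (fun e => has (p ^~ e) (iota 0 (N e))).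
Proof.
move=> cN cp; apply: computable_eq (computable_negb
  (@computable_all (fun i e => ~~ p i e) _ cN (computable_negb cp))) => e.
by rewrite -has_predC; congr nat_of_bool; apply: eq_has => i /=; rewrite negbK.
Qed.

Lemma computable_iter f : computable1 f -> computable2 (fun n => iter n f).
Proof.
move=> cf; apply: computable_eq (computable_natrec (B := nth 0 ^~ 1)
  (F := fun _ a _ => f a) (N := nth 0 ^~ 0) _ _ _).
- by move=> e; elim: (nth 0 e 0) => //= n ->.
- exact: computable_var.
- exact: computable_var.
exact: computable_app1 cf (computable_var 1).
Qed.

Lemma computable_sum f : computable1 f -> computable1 (fun n => \sum_(i < n) f i).
Proof.
move=> cf; apply: computable_eq (computable_natrec (B := fun=> 0)
  (F := fun n a _ => a + f n) (N := nth 0 ^~ 0) _ _ _).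
- by move=> e; elim: (nth 0 e 0) => [|n IHn]; rewrite ?big_ord0 // big_ord_recr /= -IHn.
- exact: computable_const.
- exact: computable_var.
exact: computable_app2 computable_add (computable_var 1)
  (computable_app1 cf (computable_var 0)).
Qed.

(** A finite table is a nested case distinction, so it is computable however its entries were
    chosen. *)
Lemma computable_nth s : computable1 (nth 0 s).
Proof.
elim: s => [|x s IHs].
  by apply: computable_eq (computable_const 0) => e; rewrite nth_nil.
apply: computable_eq (computable_if
  (computable_eqn (computable_var 0) (computable_const 0))
  (computable_const x)
  (computable_app1 IHs (computable_app1 computable_pred (computable_var 0)))) => e.
by case: (nth 0 e 0).
Qed.

Lemma computable_nth2 ss : computable2 (fun i => nth 0 (nth [::] ss i)).
Proof.
elim: ss => [|s ss IHss].
  by apply: computable_eq (computable_const 0) => e; rewrite !nth_nil.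
apply: computable_eq (computable_if
  (computable_eqn (computable_var 0) (computable_const 0))
  (computable_app1 (computable_nth s) (computable_var 1))
  (computable_app2 IHss (computable_app1 computable_pred (computable_var 0))
    (computable_var 1))) => e.
by case: (nth 0 e 0).
Qed.

(** The quotient is counted up: it grows at [n.+1] exactly when [n.+1] is the next multiple of
    [k]. *)
Lemma computable_divn k : computable1 (divn^~ k).
Proof.
have [-> | k_gt0] := posnP k.
  by apply: computable_eq (computable_const 0) => e.
apply: computable_eq (computable_natrec (B := fun=> 0)
  (F := fun n a _ => a + (n.+1 == a.+1 * k)) (N := nth 0 ^~ 0) _ _ _).
- move=> e; elim: (nth 0 e 0) => [|n /= ->]; first by rewrite div0n.
  rewrite divnS // addnC; congr (nat_of_bool _ + _).
  apply/eqP/idP => [-> | dvd_k]; first exact: dvdn_mull.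
  by rewrite -[LHS](divnK dvd_k) divnS // dvd_k.
- exact: computable_const.
- exact: computable_var.
exact: computable_app2 computable_add (computable_var 1) (computable_eqn
  (computable_app1 computable_succ (computable_var 0))
  (computable_app2 computable_mul (computable_app1 computable_succ (computable_var 1))
    (computable_const k))).
Qed.

Lemma computable_modn k : computable1 (modn^~ k).
Proof.
apply: computable_eq (computable_app2 computable_sub (computable_var 0)
  (computable_app2 computable_mul (computable_app1 (computable_divn k) (computable_var 0))
    (computable_const k))) => e.
by rewrite {1}(divn_eq (nth 0 e 0) k) addKn.
Qed.

End Environments.

(** * Codes of words *)

Section WordCodes.
Variable X : finType.
Local Notation K := #|{: X * bool}|.

(** The digits of bijective numeration run from 1 to [K], hence the predecessor before dividing. The
    code 0 of the empty word is fixed by [code_behead]. *)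
Definition code_behead (n : nat) : nat := n.-1 %/ K.
Definition code_head (n : nat) : nat := n.-1 %% K.
Definition code_drop (i n : nat) : nat := iter i code_behead n.

(** The entries follow [enum_rank], so [code_head] of a nonempty word is the index of the entry of
    its first letter. *)
Definition letter_table (T : Type) (g : letter X -> T) : seq T :=
  [seq g a | a <- enum {: X * bool}].

(* On codes, (i, u, v) |-> (the first i letters of u)^-1 v. *)
Definition code_winv_take (i n z : nat) : nat :=
  nat_rect (fun=> nat) z (fun j c =>
    if code_drop j n == 0 then c
    else nth 0 (letter_table (fun a => (enum_rank (linv a)).+1))
           (code_head (code_drop j n)) + K * c) i.

(** A code bounds the length of its word, so taking [n] letters takes them all. *)
Definition code_winv_cat (n z : nat) : nat := code_winv_take n n z.

Lemma code_behead_word (w : word X) : code_behead (word_code w) = word_code (behead w).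
Proof.
case: w => [|a w]; rewrite /code_behead; first exact: div0n.
have lt_a : enum_rank a < K by [].
rewrite /= addnC mulnC divnMDl ?divn_small ?addn0 //.
exact: leq_ltn_trans lt_a.
Qed.

Lemma code_drop_word i (w : word X) : code_drop i (word_code w) = word_code (drop i w).
Proof.
elim: i => [|i IHi]; first by rewrite drop0.
rewrite /code_drop iterS -/(code_drop i _) IHi code_behead_word.
by rewrite -drop1 drop_drop.
Qed.

Lemma letter_table_head (T : Type) (x0 : T) (g : letter X -> T) a (w : word X) :
  nth x0 (letter_table g) (code_head (word_code (a :: w))) = g a.
Proof.
have lt_a : enum_rank a < K by [].
rewrite /code_head /= addnC mulnC modnMDl modn_small //.
by rewrite (nth_map a) ?nth_enum_rank // -cardE.
Qed.

Lemma code_eq0 (w : word X) : (word_code w == 0) = (w == [::]).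
Proof. by case: w. Qed.

Lemma code_winv_takeE i (u v : word X) :
  code_winv_take i (word_code u) (word_code v) = word_code (winv (take i u) ++ v).
Proof.
elim: i => [|i IHi] /=; first by rewrite take0.
rewrite code_drop_word code_eq0 {}IHi.
have [le_u | lt_i] := leqP (size u) i.
  by rewrite drop_oversize // eqxx !take_oversize // leqW.
case def_u: (drop i u) => [|a u'] /=.
  by have := size_drop i u; rewrite def_u /= => /esym/eqP; rewrite subn_eq0 leqNgt lt_i.
rewrite letter_table_head -[take i.+1 u](cat_take_drop i).
have -> : take i (take i.+1 u) = take i u by rewrite take_takel.
have -> : drop i (take i.+1 u) = [:: a].
  by rewrite -addn1 addnC -take_drop def_u /= take0.
by rewrite winv_cat.
Qed.

Hypothesis K_gt0 : 0 < K.

Lemma size_word_code (w : word X) : size w <= word_code w.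
Proof.
elim: w => //= a w IHw; rewrite addSn ltnS (leq_trans IHw) //.
by rewrite (leq_trans (leq_pmull _ K_gt0)) // leq_addl.
Qed.

Lemma code_winv_catE (u v : word X) :
  code_winv_cat (word_code u) (word_code v) = word_code (winv u ++ v).
Proof.
by rewrite /code_winv_cat code_winv_takeE take_oversize ?size_word_code.
Qed.

Lemma word_code_surj n : exists w : word X, word_code w = n.
Proof.
elim/ltn_ind: n => -[|n] IHn; first by exists [::].
have [w def_w] := IHn (n %/ K) (leq_ltn_trans (leq_div n K) (ltnSn n)).
exists ((enum_val (Ordinal (ltn_pmod n K_gt0)) : letter X) :: w) => /=.
by rewrite enum_valK /= def_w addSn addnC mulnC -divn_eq.
Qed.

(** This is the numeral with [m] digits all equal to the largest digit [K]. *)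
Definition code_bound (m : nat) : nat := iter m (fun c => K + K * c) 0.

Lemma word_code_bound m (w : word X) : size w <= m -> word_code w <= code_bound m.
Proof.
elim: m w => [|m IHm] [|a w] //= /IHm le_w.
by rewrite leq_add ?leq_mul.
Qed.

Section Computability.
Variables (m : nat) (O : m.-tuple nat -> nat).

Lemma computable_code_behead : computable1 O code_behead.
Proof.
exact: computable_app1 (computable_divn O K)
  (computable_app1 (computable_pred O) (computable_var O 0)).
Qed.

Lemma computable_code_head : computable1 O code_head.
Proof.
exact: computable_app1 (computable_modn O K)
  (computable_app1 (computable_pred O) (computable_var O 0)).
Qed.

Lemma computable_code_drop : computable2 O code_drop.
Proof. exact: computable_iter computable_code_behead. Qed.

Lemma computable_code_winv_take : computable3 O code_winv_take.
Proof.
apply: computable_natrec (computable_var O 2) (computable_var O 0) _.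
have cd : computable O (fun e => code_drop (nth 0 e 0) (nth 0 (drop 2 e) 1)).
  exact: computable_app2 computable_code_drop (computable_var O 0)
    (computable_shift 2 (computable_var O 1)).
apply: computable_if (computable_eqn cd (computable_const O 0)) (computable_var O 1) _.
exact: computable_app2 (computable_add O)
  (computable_app1 (computable_nth O _) (computable_app1 computable_code_head cd))
  (computable_app2 (computable_mul O) (computable_const O K) (computable_var O 1)).
Qed.

Lemma computable_code_winv_cat : computable2 O code_winv_cat.
Proof.
exact: computable_app3 computable_code_winv_take (computable_var O 0) (computable_var O 0)
  (computable_var O 1).
Qed.

Lemma computable_code_bound : computable1 O code_bound.
Proof.
apply: computable_app2 (computable_iter _) (computable_var O 0) (computable_const O 0).
exact: computable_app2 (computable_add O) (computable_const O K)
  (computable_app2 (computable_mul O) (computable_const O K) (computable_var O 0)).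
Qed.

End Computability.

End WordCodes.

(** * Reductions *)

Section Problems.
Variable X : finType.
Local Notation K := #|{: X * bool}|.

Lemma turing_reducible_refl (P : problem X) : turing_reducible P P.
Proof. exact: rec_oracle. Qed.

Lemma turing_reducible_trans (P Q T : problem X) :
  turing_reducible P Q -> turing_reducible Q T -> turing_reducible P T.
Proof. by move=> PQ QT; apply: recursive_in_trans QT PQ. Qed.

(** The boolean form of [char_fun], for a bare predicate instead of a problem. *)
Definition ask k (h : k.-tuple (word X) -> Prop) (v : k.-tuple nat) : bool :=
  `[< exists2 t : k.-tuple (word X), [tuple of map (@word_code X) t] = v & h t >].

Lemma tuple1_inv (T : Type) (t : 1.-tuple T) : exists x, t = [tuple x].
Proof. by case/tupleP: t => x t; exists x; rewrite (tuple0 t); apply: val_inj. Qed.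

Lemma tuple2_inv (T : Type) (t : 2.-tuple T) : exists x y, t = [tuple x; y].
Proof.
case/tupleP: t => x t; have [y ->] := tuple1_inv t; exists x, y.
exact: val_inj.
Qed.

Lemma ask_code k (h : k.-tuple (word X) -> Prop) (t : k.-tuple (word X)) :
  ask h [tuple of map (@word_code X) t] = `[< h t >].
Proof.
apply/asboolP/asboolP => [[t' /(congr1 val) /= tt' ht'] | ht]; last by exists t.
suff -> : t = t' by [].
by apply/val_inj/esym; apply: inj_map tt'; apply: word_code_inj.
Qed.

Lemma ask_code1 (h : 1.-tuple (word X) -> Prop) w :
  ask h [tuple word_code w] = `[< h [tuple w] >].
Proof. by rewrite -ask_code; congr ask; apply: val_inj. Qed.

Lemma ask_code2 (h : 2.-tuple (word X) -> Prop) u v :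
  ask h [tuple word_code u; word_code v] = `[< h [tuple u; v] >].
Proof. by rewrite -ask_code; congr ask; apply: val_inj. Qed.

Lemma computable_ask1 m (O : m.-tuple nat -> nat) (h : 1.-tuple (word X) -> Prop) :
  recursive_in O (fun v : 1.-tuple nat => ask h v) ->
  computable1 O (fun n => ask h [tuple n]).
Proof.
move=> /computable_tuple/(_ (fun _ => computable_var O 0)).
apply: computable_eq => e; congr (nat_of_bool (ask h _)).
by apply: eq_from_tnth => i; rewrite tnth_mktuple (tnth_nth 0) ord1.
Qed.

Lemma computable_ask2 m (O : m.-tuple nat -> nat) (h : 2.-tuple (word X) -> Prop) :
  recursive_in O (fun v : 2.-tuple nat => ask h v) ->
  computable2 O (fun n p => ask h [tuple n; p]).
Proof.
move=> /computable_tuple/(_ (fun i : 'I_2 => computable_var O i)).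
apply: computable_eq => e; congr (nat_of_bool (ask h _)).
by apply: eq_from_tnth => i; rewrite tnth_mktuple (tnth_nth 0); case: i => -[|[]].
Qed.

(** As soon as there is a letter, every number is a code, so a decision procedure has to be checked
    on codes of words only. *)
Lemma recursive_in_ask m (O : m.-tuple nat -> nat) k (h : k.-tuple (word X) -> Prop)
    (p : seq nat -> bool) :
  0 < K -> computable_pred_env O p ->
  (forall t : k.-tuple (word X), p (map (@word_code X) t) <-> h t) ->
  recursive_in O (fun v : k.-tuple nat => ask h v).
Proof.
move=> K_gt0 cp ph; apply: recursive_in_eq (cp k) => v.
have [f def_f] := choice (word_code_surj K_gt0).
have -> : v = [tuple of map (@word_code X) [tuple of map f v]].
  by apply: eq_from_tnth => i; rewrite !tnth_map def_f.
by rewrite ask_code; congr nat_of_bool; apply/idP/asboolP => /ph.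
Qed.

(** Only the tuple of empty words exists, so the characteristic function of [P] is nonzero at most
    at the zero tuple. Testing two variables suffices for arity at most 2, missing ones being read
    as 0. *)
Lemma turing_reducible_no_letter (P Q : problem X) :
  K = 0 -> arity P <= 2 -> turing_reducible P Q.
Proof.
move=> K0 aP.
have word0 (w : word X) : w = [::].
  by case: w => // a w; have := max_card (pred1 (a : X * bool)); rewrite card1 K0.
pose p e := (nth 0 e 0 == 0) && (nth 0 e 1 == 0).
have cp m (O : m.-tuple nat -> nat) : computable_pred_env O p.
  exact: computable_andb (computable_eqn (computable_var O 0) (computable_const O 0))
    (computable_eqn (computable_var O 1) (computable_const O 0)).
pose t0 := [tuple ([::] : word X) | i < arity P].
have def_t0 (t : (arity P).-tuple (word X)) : t = t0.
  by apply: eq_from_tnth => i; rewrite tnth_mktuple.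
apply: recursive_in_eq (computable_andb (cp _ _)
  (computable_const _ `[< holds t0 >]) (arity P)) => v.
rewrite /char_fun; congr nat_of_bool.
apply/andP/asboolP => [[/andP[/eqP v0 /eqP v1] /asboolP ht] | [t <-]].
  exists t0 => //; apply: eq_from_tnth => i; rewrite tnth_map tnth_mktuple (tnth_nth 0).
  by have := leq_trans (ltn_ord i) aP; case: (nat_of_ord i) => [|[|//]] _; rewrite ?v0 ?v1.
rewrite (def_t0 t) => ht; split; last by apply/asboolP.
have code0 i : nth 0 [seq word_code w | w <- t0] i = 0.
  have [le_i | lt_i] := leqP (size [seq word_code w | w <- t0]) i.
    exact: nth_default.
  by rewrite (nth_map [::]) -?(size_map (@word_code X)) // (word0 (nth _ _ _)).
by rewrite /p !code0.
Qed.
End Problems.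

(** * Words and distances in the components of the Cayley graph *)

Section WordLength.
Local Open Scope group_scope.

Lemma ex_least (P : nat -> Prop) n : P n -> exists m, least P m.
Proof.
move=> Pn; have exP : exists m, `[< P m >] by exists n; apply/asboolP.
case: (ex_minnP exP) => m /asboolP Pm m_min; exists m; split=> // k Pk.
exact/m_min/asboolP.
Qed.

Lemma least_le (P : nat -> Prop) m n : least P m -> P n -> (m <= n)%N.
Proof. by case=> _; apply. Qed.

Variables (S : starMonoidType) (X : Type) (gen : X -> S).
Hypothesis S_inverse : inverse_monoid S.

Lemma component_path_word s t n :
  component_path gen s t n -> exists2 w, t = s * weval gen w & size w = n.
Proof.
elim=> {s t n} [s | s t u n [_ [a ->]] _ [w -> <-]].
  by exists [::]; rewrite ?weval_nil ?mulg1.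
by exists (a :: w); rewrite //= weval_cons mulgA.
Qed.

Lemma word_component_path s w :
  R_related (s * weval gen w) s -> component_path gen s (s * weval gen w) (size w).
Proof.
elim: w s => [|a w IHw] s; first by rewrite weval_nil mulg1 => _; apply: path_nil.
rewrite weval_cons mulgA => sw; have sa := R_related_mulK S_inverse sw.
apply: path_step (IHw _ _); last by rewrite /R_related sa.
by split; [rewrite /R_related sa | exists a].
Qed.

End WordLength.

(** * The cycle of four reductions *)

Section Reductions.
Local Open Scope group_scope.
Variables (S : starMonoidType) (X : finType) (gen : X -> S).
Variables (G : groupType) (sigma : S -> G).
Hypothesis S_inverse : inverse_monoid S.
Hypothesis S_generated : generates gen.
Hypothesis S_special : special S.
Hypothesis sigma_morph : monoid_morphism sigma.
Hypothesis S_E_unitary : E_unitary sigma.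
Hypothesis S_distortion : recursively_bounded_group_distortion gen sigma.
Hypothesis G_decidable : decidable_problem (word_problem (sigma \o gen)).
Hypothesis K_gt0 : (0 < #|{: X * bool}|)%N.

Lemma identity_le_word :
  turing_reducible (identity_problem gen) (word_problem gen).
Proof.
set hQ := fun t : 2.-tuple (word X) => weval gen (nth [::] t 0) = weval gen (nth [::] t 1).
have cQ := computable_ask2 (rec_oracle (fun v => ask hQ v)).
(* The constant 0 is the code of the empty word. *)
apply: recursive_in_ask K_gt0
  (computable_app2 cQ (computable_var _ 0) (computable_const _ 0)) _ => t.
rewrite (tuple_eta t) /= -[0%N]/(word_code ([::] : word X)) ask_code2 theadE.
by rewrite -(weval_nil gen); split=> /asboolP.
Qed.

Lemma R_class_le_identity :
  turing_reducible (R_class_of_one_problem gen) (identity_problem gen).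
Proof.
set hQ := fun t : 1.-tuple (word X) => weval gen (thead t) = 1.
have cQ := computable_ask1 (rec_oracle (fun v => ask hQ v)).
have cV := computable_code_winv_cat X (fun v => ask hQ v).
(* This computes the code of the inverse of u; feeding it twice to [cV] gives the code of u times
   its inverse. *)
have cw := computable_app2 cV (computable_var _ 0) (computable_const _ 0).
apply: recursive_in_ask K_gt0 (computable_app1 cQ (computable_app2 cV cw cw)) _ => t.
rewrite (tuple_eta t) /= -[0%N]/(word_code ([::] : word X)) !code_winv_catE // ask_code1.
rewrite !theadE cats0 winvK /R_related invg1 mulg1.
by split=> /asboolP; rewrite /hQ /= theadE weval_cat weval_winv.
Qed.

(** The reduction searches, among finitely many words, for one in the R-class of 1 that equals the
    given word in G. *)
Lemma prefix_le_R_class :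
  turing_reducible (prefix_membership_problem gen sigma) (R_class_of_one_problem gen).
Proof.
have [phi phi_rec phi_bound] := S_distortion.
set hQ := fun t : 1.-tuple (word X) => R_related (weval gen (thead t)) 1.
set hG := fun t : 2.-tuple (word X) => weval (sigma \o gen) (nth [::] t 0) =
                                      weval (sigma \o gen) (nth [::] t 1).
pose O := fun v => nat_of_bool (ask hQ v).
have cQ : computable1 O _ := computable_ask1 (rec_oracle _).
have cG : computable2 O _ := computable_ask2
  (recursive_recursive_in _ G_decidable : recursive_in O (fun v => ask hG v)).
have cphi : computable1 O phi.
  move: (recursive_recursive_in O phi_rec).
  move=> /computable_tuple/(_ (fun _ => computable_var O 0)).
  by apply: computable_eq => e; rewrite /thead tnth_mktuple.
(* The length in G of the word with code [n] is at most [n], and the sum majorizes [phi] on all such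
   lengths without any monotonicity. [code_bound] turns the bound on lengths into one on codes, and
   the last successor makes the range of [iota] include it. *)
pose B n := (code_bound X (\sum_(i < n.+1) phi i)).+1.
have cB : computable1 O B.
  exact: computable_app1 (computable_succ O) (computable_app1 (computable_code_bound X O)
    (computable_app1 (computable_sum cphi)
      (computable_app1 (computable_succ O) (computable_var O 0)))).
have c_search := @computable_has _ O
  (fun c e => ask hQ [tuple c] && ask hG [tuple c; nth 0%N e 0]) _ cB
  (computable_andb (computable_app1 cQ (computable_var O 0))
     (computable_app2 cG (computable_var O 0) (computable_shift 1 (computable_var O 0)))).
apply: (recursive_in_ask K_gt0 c_search) => t.
have [w ->] := tuple1_inv t; rewrite [map _ _]/= [X in _ <-> X]/=.
have sw := sigma_weval S_inverse sigma_morph gen.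
split=> [/hasP[c _] | [s s1 def_s]].
  have [u <-] := word_code_surj K_gt0 c.
  rewrite ask_code1 ask_code2 => /andP[/asboolP u1 /asboolP uw].
  by exists (weval gen u) => //; rewrite -sw.
(* For completeness of the search, a word for [s] provides a path from 1 to [s] in the R-class of 1;
   a shortest such path has length bounded by the distortion and spells the word to be found. *)
have [c0 def_c0] := S_generated s.
have s_path : component_path gen (s * s^-1) s (size c0).
  rewrite s1 invg1 mulg1 -[s in component_path _ _ s]mul1g -def_c0.
  by apply: word_component_path => //; rewrite mul1g def_c0.
have [m m_len] := ex_least s_path.
have w_len : exists2 u : word X, weval (sigma \o gen) u = sigma s & size u = size w.
  by exists w.
have [n n_len] := @ex_least (fun k => exists2 u : word X,
  weval (sigma \o gen) u = sigma s & size u = k) _ w_len.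
have le_m := phi_bound s m n m_len n_len.
have le_n := leq_trans (least_le n_len w_len) (size_word_code K_gt0 w).
have [u def_u size_u] := component_path_word (proj1 m_len).
rewrite s1 invg1 mulg1 mul1g in def_u.
apply/hasP; exists (word_code u).
  rewrite mem_iota /= add0n ltnS; apply: word_code_bound.
  rewrite size_u (leq_trans le_m) //.
  by rewrite (bigD1 (Ordinal (le_n : n < (word_code w).+1)%N)) //= leq_addr.
rewrite ask_code1 ask_code2; apply/andP; split; apply/asboolP.
  by rewrite /hQ theadE -def_u.
by rewrite /hG /= sw -def_u def_s.
Qed.

Lemma word_le_prefix :
  turing_reducible (word_problem gen) (prefix_membership_problem gen sigma).
Proof.
have [Q [N word_criterion]] := eq_weval_extended_prefix S_inverse S_generated
  S_special sigma_morph S_E_unitary.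
set hP := fun t : 1.-tuple (word X) => prefix_monoid sigma (weval (sigma \o gen) (thead t)).
set hG := fun t : 2.-tuple (word X) => weval (sigma \o gen) (nth [::] t 0) =
                                      weval (sigma \o gen) (nth [::] t 1).
pose O := fun v => nat_of_bool (ask hP v).
have cP : computable1 O _ := computable_ask1 (rec_oracle _).
have cG : computable2 O _ := computable_ask2
  (recursive_recursive_in _ G_decidable : recursive_in O (fun v => ask hG v)).
(* There are finitely many letters and [l <= N], so the chosen words [Q a l] fit in a finite table
   of codes. *)
pose tab := letter_table (fun a => mkseq (fun l => word_code (Q a l)) N.+1).
(* The inverse of the first [i] letters is computed first; [code_winv_cat] inverts it back in front
   of the word from the table. *)
pose ext i l n := code_winv_cat X (code_winv_take X i n 0)
  (if code_drop X i n == 0%N then 0%N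
   else nth 0%N (nth [::] tab (code_head X (code_drop X i n))) l).
have extE i l (u : word X) : (l <= N)%N ->
    ext i l (word_code u) = word_code (extended_prefix Q u i l).
  move=> le_l; rewrite /ext -[X in code_winv_take _ _ _ X]/(word_code ([::] : word X)).
  rewrite code_winv_takeE cats0 code_drop_word code_eq0 /extended_prefix.
  case: (drop i u) => [|a u'] /=.
    by rewrite -[X in code_winv_cat _ _ X]/(word_code ([::] : word X)) code_winv_catE // winvK.
  rewrite letter_table_head nth_mkseq // code_winv_catE // winvK //.
have c_ext : computable3 O ext.
  have cd := computable_app2 (computable_code_drop X O)
    (computable_var O 0) (computable_var O 2).
  exact: computable_app2 (computable_code_winv_cat X O)
    (computable_app3 (computable_code_winv_take X O) (computable_var O 0)
       (computable_var O 2) (computable_const O 0))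
    (computable_if (computable_eqn cd (computable_const O 0)) (computable_const O 0)
      (computable_app2 (computable_nth2 O tab) (computable_app1 (computable_code_head X O) cd)
         (computable_var O 1))).
pose near n m := all (fun i => all (fun l => has (fun j => has (fun k =>
    ask hP [tuple code_winv_cat X (ext j k m) (ext i l n)])
  (iota 0 N.+1)) (iota 0 m.+1)) (iota 0 N.+1)) (iota 0 n.+1).
have c_near : computable2 O (fun n m => near n m).
  have c_succ F (cF : computable O F) := computable_app1 (computable_succ O) cF.
  (* Under the four quantifiers the environment is [k, j, l, i, n, m], innermost variable first. *)
  pose k_ := computable_var O 0.
  pose j_ := computable_shift 1 (computable_var O 0).
  pose l_ := computable_shift 1 j_.
  pose i_ := computable_shift 1 l_.
  pose n_ := computable_shift 1 i_.
  pose m_ := computable_shift 1 (computable_shift 1 (computable_shift 1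
    (computable_shift 1 (computable_var O 1)))).
  have c_hit := computable_app1 cP (computable_app2 (computable_code_winv_cat X O)
    (computable_app3 c_ext j_ k_ m_) (computable_app3 c_ext i_ l_ n_)).
  pose hit k j l i n m := ask hP [tuple code_winv_cat X (ext j k m) (ext i l n)].
  pose x0 e := nth 0%N e 0; pose x1 e := nth 0%N e 1; pose d e : seq nat := drop 1 e.
  have c_k := @computable_has _ O
    (fun k e => hit k (x0 e) (x0 (d e)) (x0 (d (d e)))
      (x0 (d (d (d e)))) (x1 (d (d (d e)))))
    _ (computable_const O N.+1) c_hit.
  have c_j := @computable_has _ O (fun j e => has (fun k =>
    hit k j (x0 e) (x0 (d e)) (x0 (d (d e))) (x1 (d (d e)))) _)
    _ (c_succ _ (computable_shift 1 (computable_shift 1 (computable_var O 1)))) c_k.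
  have c_l := @computable_all _ O (fun l e => has (fun j => has (fun k =>
    hit k j l (x0 e) (x0 (d e)) (x1 (d e))) _) (iota 0 (x1 (d e)).+1))
    _ (computable_const O N.+1) c_j.
  exact: (@computable_all _ O (fun i e => all (fun l => has (fun j => has (fun k =>
    hit k j l i (x0 e) (x1 e)) _) (iota 0 (x1 e).+1)) _)
    _ (c_succ _ (computable_var O 0)) c_l).
have le_iota i n : (i <= n)%N -> i \in iota 0 n.+1 by rewrite mem_iota ltnS.
have nearE (u v : word X) : reflect (forall i l, (i <= word_code u)%N -> (l <= N)%N ->
      exists j k, [/\ (j <= word_code v)%N, (k <= N)%N &
        prefix_monoid sigma (weval (sigma \o gen)
          (winv (extended_prefix Q v j k) ++ extended_prefix Q u i l))])
   (near (word_code u) (word_code v)).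
  have hit i l j k : (l <= N)%N -> (k <= N)%N ->
      ask hP [tuple code_winv_cat X (ext j k (word_code v)) (ext i l (word_code u))] =
      `[< prefix_monoid sigma (weval (sigma \o gen)
            (winv (extended_prefix Q v j k) ++ extended_prefix Q u i l)) >].
    by move=> le_l le_k; rewrite !extE // code_winv_catE // ask_code1 /hP theadE.
  apply: (iffP allP) => [near_uv i l le_i le_l | near_uv i].
    have /allP/(_ l) := near_uv i (le_iota _ _ le_i).
    case/(_ (le_iota _ _ le_l))/hasP => j; rewrite mem_iota ltnS => le_j.
    case/hasP => k; rewrite mem_iota ltnS => le_k; rewrite hit // => /asboolP.
    by exists j, k.
  rewrite mem_iota ltnS => le_i; apply/allP => l; rewrite mem_iota ltnS => le_l.
  have [j [k [le_j le_k uv]]] := near_uv i l le_i le_l.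
  apply/hasP; exists j; first exact: le_iota.
  by apply/hasP; exists k; [exact: le_iota | rewrite hit //; apply/asboolP].
have c_word := @computable_andb _ O (fun e => ask hG [tuple nth 0%N e 0; nth 0%N e 1]) _ cG
  (@computable_andb _ O (fun e => near (nth 0%N e 0) (nth 0%N e 1)) _ c_near
    (computable_app2 c_near (computable_var O 1) (computable_var O 0))).
apply: (recursive_in_ask K_gt0 c_word) => t.
have [u [v ->]] := tuple2_inv t.
have := word_criterion u v _ _ (size_word_code K_gt0 u) (size_word_code K_gt0 v).
rewrite ask_code2 => /= ->.
split=> [/and3P[/asboolP uv /nearE near_u /nearE near_v] | [uv near_u near_v]] //.
by apply/and3P; split; [apply/asboolP | apply/nearE | apply/nearE].
Qed.

End Reductions.

Unset Implicit Arguments.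

Theorem theorem5p7 (S : starMonoidType) (X : finType) (gen : X -> S)
    (G : groupType) (sigma : S -> G)
    (S_inverse : inverse_monoid S)
    (S_generated : generates gen)
    (S_special : special S)
    (sigma_max : maximal_group_image sigma)
    (S_E_unitary : E_unitary sigma)
    (S_distortion : recursively_bounded_group_distortion gen sigma)
    (G_decidable : decidable_problem (word_problem (sigma \o gen))) :
  List.ForallPairs (@turing_equivalent X)
    [:: word_problem gen;
        identity_problem gen;
        R_class_of_one_problem gen;
        prefix_membership_problem gen sigma].
Proof.
have [sigma_morph _ _] := sigma_max.
have reducible P Q : List.In P [:: word_problem gen; identity_problem gen;
      R_class_of_one_problem gen; prefix_membership_problem gen sigma] ->
    List.In Q [:: word_problem gen; identity_problem gen;
      R_class_of_one_problem gen; prefix_membership_problem gen sigma] ->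
    @turing_reducible X P Q.
  (* Without letters 0 is the only code, and the reductions below do not apply. *)
  have [K0 | K_gt0] := posnP #|{: X * bool}|.
    by move=> inP _; apply: turing_reducible_no_letter => //;
      case: inP => [<-|[<-|[<-|[<-|[]]]]].
  (* The name [rij] stands for the reduction of problem (i) to problem (j); the cycle is closed
     under transitivity. *)
  have r21 := identity_le_word gen K_gt0.
  have r32 := R_class_le_identity gen K_gt0.
  have r43 := prefix_le_R_class S_inverse S_generated sigma_morph S_distortion
    G_decidable K_gt0.
  have r14 := word_le_prefix S_inverse S_generated S_special sigma_morph
    S_E_unitary G_decidable K_gt0.
  have r13 := turing_reducible_trans r14 r43.
  have r12 := turing_reducible_trans r13 r32.
  have r42 := turing_reducible_trans r43 r32.
  have r41 := turing_reducible_trans r42 r21.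
  have r31 := turing_reducible_trans r32 r21.
  have r34 := turing_reducible_trans r31 r14.
  have r24 := turing_reducible_trans r21 r14.
  have r23 := turing_reducible_trans r24 r43.
  by case=> [<-|[<-|[<-|[<-|[]]]]] [<-|[<-|[<-|[<-|[]]]]] //;
    apply: turing_reducible_refl.
by move=> P Q inP inQ; split; apply: reducible.
Qed.
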